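(* Let $(X,\mathcal S,U,f)$ be a splitting structure on a complete metric space $X$ satisfying condition (S5), and assume $A_\infty(B)=B$ for every $B\in\mathcal B(X)$. Let $\phi:X\to X$ be a bi-Lipschitz homeomorphism, i.e. there is $L>0$ with $L^{-1}\mathbf d(x_1,x_2)\le\mathbf d(\phi(x_1),\phi(x_2))\le L\,\mathbf d(x_1,x_2)$ for all $x_1,x_2\in X$. Then there exists a constant $C>0$ such that for every ball $B\in\mathcal B(X)$, every sequence $\mathcal R$ in $U$, every two-parameter real sequence $\mathbf r=(r_{m,n})$ and every $(B,\mathcal R,\mathbf r)$-Cantor set $\mathcal K$, the image $\phi(\mathcal K)$ contains some $(I\phi(B),\mathcal R,C\mathbf r)$-Cantor set, where $C\mathbf r:=(Cr_{m,n})_{0\le m\le n}$.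
   Context: Let $(X,\mathbf d)$ be a metric space and $\mathcal B(X)$ the set of closed balls $B(x,r)=\{y:\mathbf d(x,y)\le r\}$, each with centre $\mathrm{cent}(B)=x$ and radius $\mathrm{rad}(B)=r$. A splitting structure on $X$ is a quadruple $(X,\mathcal S,U,f)$ where: $U\subset\mathbb N$ is an infinite multiplicatively closed set such that $u,v\in U$, $u\mid v$ imply $v/u\in U$; $f:U\to\mathbb N$ is completely multiplicative; and $\mathcal S$ assigns to each $B\in\mathcal B(X)$ and $u\in U$ a collection $\mathcal S(B,u)$ of closed balls contained in $B$, each of radius $\mathrm{rad}(B)/u$, such that (S1) $\#\mathcal S(B,u)=f(u)$; (S2) distinct $b_1,b_2\in\mathcal S(B,u)$ satisfy $\mathbf d(\mathrm{cent}(b_1),\mathrm{cent}(b_2))\ge 2\,\mathrm{rad}(B)/u$; (S3) $\mathcal S(B,uv)=\bigcup_{b\in\mathcal S(B,u)}\mathcal S(b,v)$. $A_u(B):=\bigcup_{b\in\mathcal S(B,u)}b$ and $A_\infty(B):=\bigcap_i A_{u_i}(B)$ for any $u_i\in U$ with $u_i\mid u_{i+1}$, $u_i\to\infty$. Condition (S5): for each $K>1$ there is $C(K,X)$ such that any ball of radius $Kr$ intersects at most $C(K,X)$ pairwise disjoint open balls of radius $r$. For $B=B(x,r)$ set $I\phi(B):=B(\phi(x),r/L)$. Generalised Cantor sets: given $B\in\mathcal B(X)$, $\mathcal R=(R_n)_{n\ge0}$ with $R_n\in U$, and reals $\mathbf r=(r_{m,n})_{0\le m\le n}$, set $\mathcal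 B_0=\{B\}$; given the collection $\mathcal B_n$, let $\mathcal I_{n+1}=\bigcup_{B_n\in\mathcal B_n}\mathcal S(B_n,R_n)$, $\mathcal I^{n+1}_{n+1}:=\mathcal I_{n+1}$, and for $k=0,1,\dots,n$ successively obtain $\mathcal I^{n-k}_{n+1}\subseteq\mathcal I^{n-k+1}_{n+1}$ by removing, for each $B_{n-k}\in\mathcal B_{n-k}$, at most $r_{n-k,n}$ balls from $\mathcal S(B_{n-k},R_{n-k}R_{n-k+1}\cdots R_n)\cap\mathcal I^{n-k+1}_{n+1}$; put $\mathcal B_{n+1}:=\mathcal I^0_{n+1}$. Any set $\bigcap_{n\ge0}\bigcup_{b\in\mathcal B_n}b$ obtained in this way (for some choice of removed balls) is called a $(B,\mathcal R,\mathbf r)$-Cantor set. *)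

(* Defs.v *)
From HB Require Import structures.
From mathcomp Require Import all_boot all_order all_algebra.
From mathcomp Require Import all_classical all_reals all_analysis.

Set Implicit Arguments.
Unset Strict Implicit.
Unset Printing Implicit Defensive.

Import Order.TTheory GRing.Theory Num.Theory.
Import numFieldNormedType.Exports.

Local Open Scope classical_set_scope.
Local Open Scope card_scope.
Local Open Scope ring_scope.

(* A closed ball carries its centre and its radius, which are in general not
   determined by its underlying set of points. *)
Definition cball (R : realType) (X : metricType R) : Type :=
  (X * {posnum R})%type.

Definition cent (R : realType) (X : metricType R) (B : cball X) : X := B.1.

Definition rad (R : realType) (X : metricType R) (B : cball X) : R := B.2%:num.

(* The library's [closed_ball] is the closure of the open ball, which may be
   smaller than the set below in a general metric space. *)
Definition pts (R : realType) (X : metricType R) (B : cball X) : set X :=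
  [set y | mdist (cent B) y <= rad B].

Definition complete_metric (R : realType) (X : metricType R) : Prop :=
  forall F : set_system X, ProperFilter F -> cauchy F -> exists x : X, F --> x.

(* The values of [sp_f] and [sp_S] at elements outside [sp_U] are irrelevant. *)
Record splitting_structure (R : realType) (X : metricType R) :=
  SplittingStructure {
  sp_U : set nat;
  sp_f : nat -> nat;
  sp_S : cball X -> nat -> set (cball X);
  sp_U_gt0 : forall u, sp_U u -> (0 < u)%N;
  sp_U_infinite : infinite_set sp_U;
  sp_U_mul : forall u v, sp_U u -> sp_U v -> sp_U (u * v)%N;
  sp_U_div : forall u v, sp_U u -> sp_U v -> (u %| v)%N -> sp_U (v %/ u)%N;
  sp_f_gt0 : forall u, sp_U u -> (0 < sp_f u)%N;
  sp_f_mul : forall u v, sp_U u -> sp_U v ->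
    sp_f (u * v)%N = (sp_f u * sp_f v)%N;
  sp_S_sub : forall B u, sp_U u -> forall b, sp_S B u b -> pts b `<=` pts B;
  sp_S_rad : forall B u, sp_U u -> forall b, sp_S B u b ->
    rad b = rad B / u%:R;
  sp_S1 : forall B u, sp_U u -> sp_S B u #= `I_(sp_f u);
  sp_S2 : forall B u, sp_U u -> forall b1 b2, sp_S B u b1 -> sp_S B u b2 ->
    b1 <> b2 -> 2 * rad B / u%:R <= mdist (cent b1) (cent b2);
  sp_S3 : forall B u v, sp_U u -> sp_U v ->
    sp_S B (u * v)%N = \bigcup_(b in sp_S B u) sp_S b v
}.

Definition sp_A (R : realType) (X : metricType R) (S : splitting_structure X)
    (u : nat) (B : cball X) : set X :=
  \bigcup_(b in sp_S S B u) pts b.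

Definition div_chain (R : realType) (X : metricType R)
    (S : splitting_structure X) (u : nat -> nat) : Prop :=
  [/\ forall i, sp_U S (u i), forall i, (u i %| u i.+1)%N & u @ \oo --> \oo].

(* By [sp_AinfE] below, this is the intersection along any single chain; the
   intersection over all chains only makes the definition choice-free. *)
Definition sp_Ainf (R : realType) (X : metricType R)
    (S : splitting_structure X) (B : cball X) : set X :=
  \bigcap_(u in div_chain S) \bigcap_i sp_A S (u i) B.

(* The disjoint open balls are indexed by their centres; [trivIset] forces
   distinct centres to have disjoint balls. *)
Definition condition_S5 (R : realType) (X : metricType R) : Prop :=
  forall K : R, 1 < K -> exists C : nat,
    forall (r : R) (B : cball X), 0 < r -> rad B = K * r ->
    forall D : set X, trivIset D (fun y => ball y r) ->
      (forall y, D y -> pts B `&` ball y r !=set0) ->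
      D #<= `I_C.

Definition homeomorphism (T U : topologicalType) (phi : T -> U) : Prop :=
  exists psi : U -> T,
    [/\ cancel phi psi, cancel psi phi, continuous phi & continuous psi].

Definition Iball (R : realType) (X : metricType R) (phi : X -> X)
    (L : {posnum R}) (B : cball X) : cball X :=
  (phi (cent B), (B.2%:num / L%:num)%:pos).

Definition at_most (R : realType) (T : Type) (A : set T) (x : R) : Prop :=
  exists2 k : nat, k%:R <= x & A #= `I_k.

(* [Bs n] is the n-th collection, and [Is n m], for m <= n.+1, is what is left
   of the children [Is n n.+1] of [Bs n] once the removals attached to the
   levels n, n-1, ..., m have been made; [rem b] is the set of balls removed
   on account of the level-m ball b. *)
Definition cantor_collections (R : realType) (X : metricType R)
    (S : splitting_structure X) (B : cball X) (Rs : nat -> nat)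
    (r : nat -> nat -> R) (Bs : nat -> set (cball X))
    (Is : nat -> nat -> set (cball X)) : Prop :=
  Bs 0%N = [set B] /\
  forall n,
    [/\ Is n n.+1 = \bigcup_(b in Bs n) sp_S S b (Rs n),
        forall m, (m <= n)%N -> exists rem : cball X -> set (cball X),
          (forall b, Bs m b ->
             rem b `<=`
               sp_S S b (\prod_(m <= i < n.+1) Rs i)%N `&` Is n m.+1 /\
             at_most (rem b) (r m n)) /\
          Is n m = Is n m.+1 `\` \bigcup_(b in Bs m) rem b
      & Bs n.+1 = Is n 0%N].

Definition cantor_set (R : realType) (X : metricType R)
    (S : splitting_structure X) (B : cball X) (Rs : nat -> nat)
    (r : nat -> nat -> R) (K : set X) : Prop :=
  exists (Bs : nat -> set (cball X)) (Is : nat -> nat -> set (cball X)),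
    cantor_collections S B Rs r Bs Is /\
    K = \bigcap_n \bigcup_(b in Bs n) pts b.

Section Ainf.
Context {R : realType} {X : metricType R} (S : splitting_structure X).

Lemma pts_cent (b : cball X) : pts b (cent b).
Proof. by rewrite /pts /= mdistxx /rad. Qed.

Lemma sp_S_mulC (B : cball X) (u v : nat) : sp_U S u -> sp_U S v ->
  \bigcup_(b in sp_S S B u) sp_S S b v = \bigcup_(b in sp_S S B v) sp_S S b u.
Proof. by move=> Uu Uv; rewrite -!sp_S3 // mulnC. Qed.

Lemma finite_gap (s : seq (cball X)) (x : X) :
  (forall b, b \in s -> ~ pts b x) ->
  exists2 e : R, 0 < e & forall b, b \in s -> rad b + e <= mdist (cent b) x.
Proof.
elim: s => [|a s IH] H; first by exists 1.
have [|e e0 He] := IH; first by move=> b bs; apply: H; rewrite inE bs orbT.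
have /negP := H a (mem_head _ _); rewrite -ltNge => ax.
exists (Num.min e (mdist (cent a) x - rad a)).
  by rewrite lt_min e0 subr_gt0.
move=> b; rewrite inE => /orP[/eqP ->|bs].
  by rewrite -lerBrDl ge_min lexx orbT.
by apply: le_trans (He b bs); rewrite lerD2l ge_min lexx.
Qed.

Lemma sp_A_chain (u : nat -> nat) (B : cball X) (v : nat) (x : X) :
  div_chain S u -> sp_U S v -> (forall i, sp_A S (u i) B x) -> sp_A S v B x.
Proof.
move=> [Uu _ uoo] Uv Hx; apply: contrapT => nx.
have /finite_seqP[s sE] : finite_set (sp_S S B v).
  by exists (sp_f S v); exact: sp_S1.
have [|e e0 He] := @finite_gap s x.
  by move=> b bs xb; apply: nx; exists b => //; rewrite sE.
have [i ui] : exists i, 2 * rad B / (u i)%:R < e.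
  have /cvgnyPge/(_ (Num.truncn (2 * rad B / e)).+1)[i _ /(_ i (leqnn _)) hi] :=
    uoo.
  exists i; have u0 : 0 < (u i)%:R :> R by rewrite ltr0n (sp_U_gt0 (Uu i)).
  rewrite ltr_pdivrMr // [ltRHS]mulrC -ltr_pdivrMr //.
  apply: (lt_le_trans (truncnS_gt _)).
  by rewrite ler_nat.
have [b Sb xb] := Hx i.
have [c Sc] : exists c, sp_S S b v c.
  have [/eqP Sb0|/set0P//] := boolP (sp_S S b v == set0).
  have := card_esym (sp_S1 b Uv); rewrite Sb0 card_eq0 => /eqP I0.
  by have : `I_(sp_f S v) 0%N := sp_f_gt0 Uv; rewrite I0.
have : (\bigcup_(b in sp_S S B (u i)) sp_S S b v) c by exists b.
rewrite sp_S_mulC // => -[d Sd Sdc].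
have /He : d \in s by move: Sd; rewrite sE.
have cd : mdist (cent d) (cent c) <= rad d := sp_S_sub (Uu i) Sdc (@pts_cent c).
have cb : mdist (cent b) (cent c) <= rad b := sp_S_sub Uv Sc (@pts_cent c).
have rb := sp_S_rad (Uu i) Sb.
have := metric_triangle (cent d) (cent c) x.
have := metric_triangle (cent c) (cent b) x.
rewrite (metric_sym (cent c) (cent b)).
move: xb; rewrite /pts /= => xb t1 t2 h.
have : e <= 2 * rad B / (u i)%:R.
  rewrite -mulrA -rb; rewrite mulr_natl mulr2n.
  rewrite -(lerD2l (rad d)); apply: (le_trans h); apply: (le_trans t2).
  by apply: lerD => //; apply: (le_trans t1); exact: lerD.
by rewrite leNgt ui.
Qed.

Lemma sp_AinfE (u : nat -> nat) (B : cball X) : div_chain S u ->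
  sp_Ainf S B = \bigcap_i sp_A S (u i) B.
Proof.
move=> hu; apply/seteqP; split => x; first by move=> /(_ u hu).
move=> Hx v [Uv _ _] i _; apply: (sp_A_chain hu (Uv i)) => j.
exact: Hx.
Qed.

End Ainf.

(* Main.v *)
Require Import Defs.
From HB Require Import structures.
From mathcomp Require Import all_boot all_order all_algebra.
From mathcomp Require Import all_classical all_reals all_analysis.
From mathcomp Require Import lra.
Import Order.TTheory GRing.Theory Num.Theory.
Import numFieldNormedType.Exports.
Local Open Scope classical_set_scope.
Local Open Scope ring_scope.

Local Notation rad := Defs.rad.

(** Let [psi] be the inverse of [phi]. In the splitting of [Iball phi L B],
    discard at step [n] every ball whose [psi]-image meets a ball discarded at
    step [n] in the construction of the given Cantor set. Since every ball is
    the union of its splitting, the [psi]-image of each surviving ball is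
    covered by the surviving balls of the same level of the given set, whence
    the inclusion.

    To count, fix a level-[m] ball b' of the new construction. A discarded
    descendant of b' meets [phi c] for some ball [c] removed on account of a
    level-[m] ball [b]. The radius of b' is that of [b] divided by [L], so [psi]
    maps b' into a ball with the radius of [b], and by (S5) only boundedly many
    such [b] can meet it; each accounts for at most [r m n] balls [c], and by
    (S5) again each [phi c] meets boundedly many balls of the new splitting. *)

(** * Arithmetic of [at_most] *)

Lemma card_le_at_most {R : realType} {T : Type} {A : set T} {n : nat} {x : R} :
  (A #<= `I_n)%card -> n%:R <= x -> at_most A x.
Proof.
move=> An nx; have /finite_setP[k Ak] : finite_set A.
  by apply/finite_set_leP; exists n.
exists k => //; apply: le_trans nx.
by rewrite ler_nat -card_le_II -(card_le_eql Ak).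
Qed.

Lemma at_most_le {R : realType} {T : Type} {A B : set T} {x y : R} :
  A `<=` B -> x <= y -> at_most B x -> at_most A y.
Proof.
move=> AB xy [k kx Bk]; apply: (@card_le_at_most _ _ _ k).
  by rewrite -(card_le_eqr Bk) subset_card_le.
exact: le_trans xy.
Qed.

Lemma at_most_ge0 {R : realType} {T : Type} {A : set T} {x : R} :
  at_most A x -> 0 <= x.
Proof. by move=> [k kx _]; apply: le_trans kx. Qed.

Lemma at_most_setU {R : realType} {T : choiceType} {A B : set T} {x y : R} :
  at_most A x -> at_most B y -> at_most (A `|` B) (x + y).
Proof.
move=> [m mx Am] [n ny Bn].
have fA : finite_set A by exists m.
have fB : finite_set B by exists n.
have cAB : (A `|` B #= `I_(size (finmap.enum_fset (fset_set (A `|` B)))))%card.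
  rewrite -[X in (X #= _)%card]fset_setK; first exact/card_eq_fsetP.
  by rewrite finite_setU.
exists (size (finmap.enum_fset (fset_set (A `|` B)))) => //.
rewrite fset_setU // finmap.cardfsU (card_fset_set Am) (card_fset_set Bn).
apply: (@le_trans _ _ (m + n)%:R); first by rewrite ler_nat leq_subr.
by rewrite natrD lerD.
Qed.

Lemma at_most_bigcup {R : realType} {T : Type} {U : choiceType} {A : set T}
    {F : T -> set U} {a x : R} :
  at_most A a -> 0 <= x -> (forall i, A i -> at_most (F i) x) ->
  at_most (\bigcup_(i in A) F i) (a * x).
Proof.
move=> [k ka Ak] x0 HF.
(* The induction runs on the exact cardinality [k] in place of [a]. The sign of [x] is a separate
   hypothesis because an empty [A] gives no bound from which to infer it. *)
suff : at_most (\bigcup_(i in A) F i) (k%:R * x).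
  by apply: at_most_le => //; exact: ler_wpM2r.
elim: k A Ak HF {ka} => [|k IH] A Ak HF.
  move: Ak; rewrite II0 card_eq0 => /eqP ->.
  by rewrite bigcup_set0 mul0r; exists 0%N => //; rewrite II0.
have /eq_cardSP[i Ai Aik] := Ak.
rewrite (bigcup_setD1 i) // -natr1 mulrDl mul1r addrC.
apply: at_most_setU; first exact: HF.
by apply: IH => // j [/HF].
Qed.

(** Open balls of radius [rho] about centres [2 * rho] apart are disjoint, so (S5) bounds the number
    of centres. The separation also makes [cent] injective on [M], so the balls themselves are
    counted. *)
Lemma packing {R : realType} {X : metricType R} (K : R) :
  condition_S5 X -> 1 < K ->
  exists C : nat, forall (rho : R) (x : X) (M : set (cball X)), 0 < rho ->
    (forall b1 b2, M b1 -> M b2 -> b1 <> b2 ->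
      2 * rho <= mdist (cent b1) (cent b2)) ->
    (forall b, M b -> mdist x (cent b) <= K * rho) ->
    at_most M (C%:R : R).
Proof.
move=> S5 K1; have [C HC] := S5 K K1; exists C => rho x M rho0 sep near.
have Krho0 : 0 < K * rho by apply: mulr_gt0 => //; apply: lt_trans K1.
have inj : {in M &, injective (@cent R X)}.
  move=> b1 b2; rewrite !inE => M1 M2 c12; apply: contrapT => b12.
  by have := sep _ _ M1 M2 b12; rewrite c12 mdistxx; lra.
apply: (@card_le_at_most _ _ _ C) => //.
rewrite -(card_le_eql (inj_card_eq inj)).
apply: (HC rho (x, PosNum Krho0)) => //.
- apply/trivIsetP => _ _ [b1 M1 <-] [b2 M2 <-] /eqP c12.
  have b12 : b1 <> b2 by move=> e; apply: c12; rewrite e.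
  apply/seteqP; split => y //; rewrite !ballEmdist => -[/= y1 y2].
  have := metric_triangle (cent b1) y (cent b2).
  have := sep _ _ M1 M2 b12; rewrite (metric_sym y (cent b2)); lra.
- move=> _ [b Mb <-]; exists (cent b); split; first exact: near.
  by rewrite ballEmdist /= mdistxx.
Qed.

(** * Splittings, coverings and nested levels *)

Lemma sp_U1 {R : realType} {X : metricType R} (S : splitting_structure X) :
  sp_U S 1%N.
Proof.
have [u Uu] : exists u, sp_U S u.
  by apply/set0P/negP => /eqP U0; have := @sp_U_infinite _ _ S; rewrite U0.
by have := sp_U_div Uu Uu (dvdnn u); rewrite divnn (sp_U_gt0 Uu).
Qed.

Lemma sp_U_prod {R : realType} {X : metricType R} (S : splitting_structure X)
    (Rs : nat -> nat) (m n : nat) :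
  (forall n, sp_U S (Rs n)) -> sp_U S (\prod_(m <= i < n) Rs i)%N.
Proof.
move=> URs; apply: (big_ind (sp_U S)) => //; first exact: sp_U1.
exact: sp_U_mul.
Qed.

(** Powers of some [u > 1]. A chain must exist for the intersection defining [sp_Ainf] to carry any
    information. *)
Lemma div_chain_ex {R : realType} {X : metricType R}
    (S : splitting_structure X) : exists u, div_chain S u.
Proof.
have [u Uu u1] : exists2 u, sp_U S u & (1 < u)%N.
  apply: contrapT => H; apply: (@sp_U_infinite _ _ S).
  apply: (sub_finite_set (B := `I_2)) => // u Uu.
  by rewrite /= ltnNge; apply/negP => u1; apply: H; exists u.
exists (fun i => u ^ i)%N; split => [i|i|].
- elim: i => [|i IH]; first exact: sp_U1.
  by rewrite expnS; exact: sp_U_mul.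
- by rewrite expnS dvdn_mull.
- apply/cvgnyPge => N; exists N => // i /= Ni.
  by apply: (leq_trans Ni); apply: ltnW; exact: ltn_expl.
Qed.

(** By [hA] the point lies in [sp_A] all along some chain, and [sp_A_chain] passes to a [u] that may
    lie off that chain. *)
Lemma pts_cover {R : realType} {X : metricType R} {S : splitting_structure X}
    (hA : forall B : cball X, sp_Ainf S B = pts B) (B : cball X) (u : nat)
    (x : X) :
  sp_U S u -> pts B x -> exists2 b, sp_S S B u b & pts b x.
Proof.
move=> Uu; rewrite -hA => Bx; have [w hw] := div_chain_ex S.
by apply: (sp_A_chain hw Uu) => i; exact: (Bx w hw).
Qed.

(** Iterated (S3). Only nestedness is assumed, so that this serves both the given collections and
    the pruned ones. *)
Lemma subset_descendants {R : realType} {X : metricType R}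
    {S : splitting_structure X} {Rs : nat -> nat} {Bs : nat -> set (cball X)}
    {m n : nat} :
  (forall n, sp_U S (Rs n)) ->
  (forall n, Bs n.+1 `<=` \bigcup_(b in Bs n) sp_S S b (Rs n)) ->
  (m <= n)%N ->
  \bigcup_(b in Bs n) sp_S S b (Rs n) `<=`
    \bigcup_(b in Bs m) sp_S S b (\prod_(m <= i < n.+1) Rs i)%N.
Proof.
move=> URs nest; elim: n => [|n IH].
  by rewrite leqn0 => /eqP ->; rewrite big_nat1.
rewrite leq_eqVlt => /predU1P[->|]; first by rewrite big_nat1.
rewrite ltnS => mn c [b Bb bc].
have [a Ba ab] := IH mn _ (nest _ _ Bb); exists a => //.
rewrite big_nat_recr /=; last exact: (leq_trans mn).
by rewrite sp_S3 //; [exists b | exact: sp_U_prod].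
Qed.

Lemma level_rad {R : realType} {X : metricType R}
    {S : splitting_structure X} {Rs : nat -> nat} {Bs : nat -> set (cball X)}
    {B b : cball X} {n : nat} :
  (forall n, sp_U S (Rs n)) ->
  Bs 0%N = [set B] ->
  (forall n, Bs n.+1 `<=` \bigcup_(b in Bs n) sp_S S b (Rs n)) ->
  Bs n b -> rad b = rad B / (\prod_(0 <= i < n) Rs i)%:R.
Proof.
move=> URs B0 nest; case: n => [|n].
  by rewrite B0 big_geq // divr1 => ->.
move=> /nest /(subset_descendants URs nest (leq0n n))[a].
rewrite B0 => -> /sp_S_rad -> //; exact: sp_U_prod.
Qed.

(* At [n = 0] the level is [[set B]] rather than [sp_S S B 1], whose only ball
   may have another centre. *)
Lemma level_separated {R : realType} {X : metricType R}
    {S : splitting_structure X} {Rs : nat -> nat} {Bs : nat -> set (cball X)}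
    {B b1 b2 : cball X} {n : nat} :
  (forall n, sp_U S (Rs n)) ->
  Bs 0%N = [set B] ->
  (forall n, Bs n.+1 `<=` \bigcup_(b in Bs n) sp_S S b (Rs n)) ->
  Bs n b1 -> Bs n b2 -> b1 <> b2 ->
  2 * (rad B / (\prod_(0 <= i < n) Rs i)%:R) <= mdist (cent b1) (cent b2).
Proof.
move=> URs B0 nest; case: n => [|n]; first by rewrite B0 => -> ->.
move=> /nest /(subset_descendants URs nest (leq0n n))[a1].
rewrite B0 => -> S1 /nest /(subset_descendants URs nest (leq0n n))[a2].
rewrite B0 => -> S2 b12; rewrite mulrA.
by apply: sp_S2 S1 S2 b12; exact: sp_U_prod.
Qed.

(** * Cantor sets from prescribed removals *)

Fixpoint pruned_levels {R : realType} {X : metricType R}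
    (S : splitting_structure X) (B : cball X) (Rs : nat -> nat)
    (bad : nat -> nat -> set (cball X)) (n : nat) : set (cball X) :=
  if n is n'.+1 then
    (\bigcup_(b in pruned_levels S B Rs bad n') sp_S S b (Rs n'))
      `\` \bigcup_(k in [set k | (k <= n')%N]) bad n' k
  else [set B].

(** A discarded ball of [bad n m] is charged to a level-[m] ancestor, so it suffices to bound
    [bad n m] among the descendants of each level-[m] ball. *)
Lemma pruned_levels_cantor {R : realType} {X : metricType R}
    (S : splitting_structure X) (B : cball X) (Rs : nat -> nat)
    (r : nat -> nat -> R) (bad : nat -> nat -> set (cball X)) :
  (forall n, sp_U S (Rs n)) ->
  (forall m n b, (m <= n)%N -> pruned_levels S B Rs bad m b ->
    at_most (sp_S S b (\prod_(m <= i < n.+1) Rs i)%N `&` bad n m) (r m n)) ->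
  cantor_set S B Rs r (\bigcap_n \bigcup_(b in pruned_levels S B Rs bad n) pts b).
Proof.
move=> URs Hbad; set Bs := pruned_levels S B Rs bad.
have nest n : Bs n.+1 `<=` \bigcup_(b in Bs n) sp_S S b (Rs n) by move=> b [].
(* The range of [k] is empty for [m = n.+1] and is all of [k <= n] for [m = 0]: the two ends of the
   removal process. *)
pose Is n m := (\bigcup_(b in Bs n) sp_S S b (Rs n))
      `\` \bigcup_(k in [set k | (m <= k <= n)%N]) bad n k.
exists Bs, Is; split => //; split => // n; split => [|m mn|//].
  rewrite /Is [X in _ `\` X](_ : _ = set0) ?setD0 //.
  by apply/seteqP; split => b // [k /= /andP[nk kn]]; have := leq_trans nk kn;
    rewrite ltnn.
exists (fun b => sp_S S b (\prod_(m <= i < n.+1) Rs i)%N `&` bad n m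
                 `&` Is n m.+1); split.
  move=> b Bb; split; first by move=> c [[]].
  by apply: at_most_le (Hbad m n b mn Bb) => // c [].
apply/seteqP; split => c.
  move=> [Sc nc]; split.
    split => // -[k /= /andP[mk kn] kc]; apply: nc; exists k => //=.
    by rewrite kn andbT ltnW.
  by move=> [b Bb [[_ bc] _]]; apply: nc; exists m => //=; rewrite leqnn.
move=> [Ic nc]; case: (Ic) => Sc nc'; split => // -[k /= /andP[mk kn] kc].
case: (ltngtP m k) mk => // [mk|mk] _.
  by apply: nc'; exists k; rewrite //= mk.
have [b Bb bc] := subset_descendants URs nest mn _ Sc.
by apply: nc; exists b => //; split => //; split => //; rewrite mk.
Qed.

Lemma cantor_collections_nested {R : realType} {X : metricType R}
    {S : splitting_structure X} {B : cball X} {Rs : nat -> nat}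
    {r : nat -> nat -> R} {Bs : nat -> set (cball X)}
    {Is : nat -> nat -> set (cball X)} :
  cantor_collections S B Rs r Bs Is ->
  forall n, Bs n.+1 `<=` \bigcup_(b in Bs n) sp_S S b (Rs n).
Proof.
move=> [_ H] n; have [<- HI ->] := H n.
suff sub m : (m <= n.+1)%N -> Is n 0%N `<=` Is n m by exact: sub.
elim: m => [_ //|m IH mn] b /(IH (ltnW mn)).
by have [rem [_ ->]] := HI m mn; case.
Qed.

(** A child absent from the next level must drop out between two consecutive stages [Is n m.+1] and
    [Is n m]. *)
Lemma cantor_collections_survive {R : realType} {X : metricType R}
    {S : splitting_structure X} {B : cball X} {Rs : nat -> nat}
    {r : nat -> nat -> R} {Bs : nat -> set (cball X)}
    {Is : nat -> nat -> set (cball X)} {n : nat} {b : cball X} :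
  cantor_collections S B Rs r Bs Is ->
  (\bigcup_(b in Bs n) sp_S S b (Rs n)) b ->
  (forall m, (m <= n)%N -> ~ (Is n m.+1 `\` Is n m) b) -> Bs n.+1 b.
Proof.
move=> [_ H]; have [<- _ ->] := H n; move=> bI nb.
suff step k : (k <= n.+1)%N -> Is n (n.+1 - k)%N b.
  by have := step n.+1 (leqnn _); rewrite subnn.
elim: k => [|k IH] kn; first by rewrite subn0.
have := nb (n.+1 - k.+1)%N; rewrite subSS leq_subr => /(_ isT) nD.
apply: contrapT => nI; apply: nD; split => //.
by rewrite -subSn //; apply: IH; exact: ltnW.
Qed.

(** When [psi] inverts [phi], these are the balls that meet [phi c] for some [c] in [D]. *)
Definition meeting {R : realType} {X : metricType R} (psi : X -> X)
    (D : set (cball X)) : set (cball X) :=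
  [set b | exists2 c, D c & exists2 z, pts b z & pts c (psi z)].

(** Induction on [n], point by point, since different points of [b] may land in different balls. Had
    the child containing [psi z] been removed, [b] would meet its image and be discarded. *)
Lemma pruned_levels_sub {R : realType} {X : metricType R}
    {S : splitting_structure X} {B B' : cball X} {Rs : nat -> nat}
    {r : nat -> nat -> R} {Bs : nat -> set (cball X)}
    {Is : nat -> nat -> set (cball X)} {psi : X -> X} :
  (forall B : cball X, sp_Ainf S B = pts B) ->
  (forall n, sp_U S (Rs n)) ->
  cantor_collections S B Rs r Bs Is ->
  (forall z, pts B' z -> pts B (psi z)) ->
  forall n b z,
    pruned_levels S B' Rs (fun n m => meeting psi (Is n m.+1 `\` Is n m)) n b ->
    pts b z -> exists2 c, Bs n c & pts c (psi z).
Proof.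
move=> hA URs HC B'B; elim => [|n IH] b z /=.
  by move=> -> /B'B; exists B => //; case: HC => ->.
move=> [[a La ab] nbad] bz.
have [d Bd dz] := IH a z La (sp_S_sub (URs n) ab bz).
have [c dc cz] := pts_cover hA d (Rs n) _ (URs n) dz.
exists c => //; apply: (cantor_collections_survive HC); first by exists d.
by move=> m mn mc; apply: nbad; exists m => //; exists c => //; exists z.
Qed.

Theorem theorem7 (R : realType) (X : metricType R)
    (S : splitting_structure X)
    (hX : complete_metric X)
    (hS5 : condition_S5 X)
    (hA : forall B : cball X, sp_Ainf S B = pts B)
    (phi : X -> X) (hphi : homeomorphism phi)
    (L : {posnum R})
    (hL : forall x1 x2 : X,
      L%:num^-1 * mdist x1 x2 <= mdist (phi x1) (phi x2) <= L%:num * mdist x1 x2) :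
  exists2 C : R, 0 < C &
    forall (B : cball X) (Rs : nat -> nat), (forall n, sp_U S (Rs n)) ->
    forall (r : nat -> nat -> R) (K : set X),
      cantor_set S B Rs r K ->
      exists2 K' : set X,
        cantor_set S (Iball phi L B) Rs (fun m n => C * r m n) K' &
        K' `<=` phi @` K.
Proof.
have [psi [phiK psiK _ _]] := hphi.
have L0 : 0 < L%:num by [].
have psi_lip y1 y2 : mdist (psi y1) (psi y2) <= L%:num * mdist y1 y2.
  have /andP[+ _] := hL (psi y1) (psi y2).
  by rewrite !psiK ler_pdivrMl.
(* The factor 2: the [psi]-image of a new level-[m] ball lies within [rad b] of the image of its
   centre, and a level-[m] ball [b] meeting it adds its own radius. *)
have [C1 HC1] := packing 2 hS5 (ltr1n _ 2).
(* If new balls have radius [s = rad c / L], then [phi c] lies within [L * rad c = L^2 * s] of the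
   image of its centre, and a new ball meeting it adds [s]. *)
have L1 : 1 < L%:num ^+ 2 + 1 by rewrite ltrDr exprn_gt0.
have [C2 HC2] := packing _ hS5 L1.
(* The [+ 1] keeps the constant positive should (S5) supply a zero bound. *)
exists (C1%:R * C2%:R + 1); first by rewrite ltr_wpDl // mulr_ge0.
move=> B Rs URs r K [Bs [Is [HC ->]]].
set B' := Iball phi L B.
have B'B z : pts B' z -> pts B (psi z).
  rewrite /pts /= => Hz; rewrite -[cent B]phiK.
  apply: (le_trans (psi_lip _ _)).
  by rewrite mulrC -ler_pdivlMr.
set bad := fun n m => meeting psi (Is n m.+1 `\` Is n m).
have sub := pruned_levels_sub hA URs HC B'B; rewrite -/bad in sub.
exists (\bigcap_n \bigcup_(b in pruned_levels S B' Rs bad n) pts b); last first.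
  move=> y Ky; exists (psi y) => // n _.
  by have [b Lb yb] := Ky n I; have [c ? ?] := sub n b y Lb yb; exists c.
have nest := cantor_collections_nested HC.
have nest' n : pruned_levels S B' Rs bad n.+1 `<=`
    \bigcup_(b in pruned_levels S B' Rs bad n) sp_S S b (Rs n) by move=> b [].
have B0 : Bs 0%N = [set B] by case: HC.
have B0' : pruned_levels S B' Rs bad 0%N = [set B'] by [].
apply: pruned_levels_cantor => // m n b' mn Lb'.
have [_ HI _] := HC.2 n; have [rem [Hrem IE]] := HI m mn.
set P := fun n => (\prod_(0 <= i < n) Rs i)%N.
have P0 k : 0 < (P k)%:R :> R.
  by rewrite ltr0n (sp_U_gt0 (sp_U_prod S Rs 0 k URs)).
have rB0 : 0 < rad B by rewrite /rad.
have rB' : rad B' = rad B / L%:num by [].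
pose rho k := rad B / (P k)%:R.
have rho0 k : 0 < rho k by rewrite divr_gt0.
set u := (\prod_(m <= i < n.+1) Rs i)%N.
have Uu : sp_U S u := sp_U_prod S Rs m n.+1 URs.
have Pu : P n.+1 = (P m * u)%N by rewrite /P /u -big_cat_nat // ltnW.
have rb' : rad b' = rho m / L%:num.
  by rewrite (level_rad URs B0' nest' Lb') rB' mulrAC.
have rb'u : rad b' / u%:R = rho n.+1 / L%:num.
  by rewrite rb' /rho Pu natrM invfM mulrA mulrAC.
pose M := Bs m `&` [set b | mdist (psi (cent b')) (cent b) <= 2 * rho m].
pose N (b : cball X) := sp_S S b' u `&`
  [set c | mdist (phi (cent b)) (cent c) <=
           (L%:num ^+ 2 + 1) * (rho n.+1 / L%:num)].
(* The sign of [r m n] is not given. It follows from the existence of a level-[m] ball of the given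
   set, here one containing [psi (cent b')], whose removals number at most [r m n]. *)
have r_ge0 : 0 <= r m n.
  have [b Bb _] := sub m b' (cent b') Lb' (@pts_cent _ _ b').
  exact: at_most_ge0 (Hrem b Bb).2.
have cN b : at_most (N b) (C2%:R : R).
  apply: (HC2 (rho n.+1 / L%:num) (phi (cent b))); first exact: divr_gt0.
    move=> c1 c2 [S1 _] [S2 _]; rewrite -rb'u mulrA.
    exact: (sp_S2 Uu S1 S2).
  by move=> c [].
have cM : at_most M (C1%:R : R).
  apply: (HC1 (rho m) (psi (cent b'))) => //.
    by move=> b1 b2 [M1 _] [M2 _]; exact: (level_separated URs B0 nest M1 M2).
  by move=> b [].
have cMN : at_most (\bigcup_(b in M) \bigcup_(c in rem b) N c)
    (C1%:R * (r m n * C2%:R)).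
  apply: at_most_bigcup cM _ _; first exact: mulr_ge0.
  by move=> b [Bb _]; apply: at_most_bigcup => //; exact: (Hrem b Bb).2.
apply: at_most_le cMN; last by nra.
move=> b'' [Sb'' [c [cI ncI] [z b''z cz]]].
have [b Bb remc] : (\bigcup_(b in Bs m) rem b) c.
  by apply: contrapT => nrem; apply: ncI; rewrite IE.
have [Sbc Ic] := (Hrem b Bb).1 _ remc.
have rb : rad b = rho m := level_rad URs B0 nest Bb.
have rc : rad c = rho n.+1.
  by rewrite (sp_S_rad Uu Sbc) rb /rho Pu natrM invfM mulrA.
have b'z := sp_S_sub Uu Sb'' b''z.
have bz := sp_S_sub Uu Sbc cz.
have rb'' : rad b'' = rho n.+1 / L%:num by rewrite (sp_S_rad Uu Sb'').
move: b'z bz b''z cz; rewrite /pts /= rb' rb rb'' rc => b'z bz b''z cz.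
exists b; [split => //=|exists c => //; split => //=].
  have := metric_triangle (psi (cent b')) (psi z) (cent b).
  have := psi_lip (cent b') z; rewrite (metric_sym (psi z)).
  have : L%:num * mdist (cent b') z <= rho m by rewrite mulrC -ler_pdivlMr.
  by lra.
have := metric_triangle (phi (cent c)) z (cent b'').
have /andP[_] := hL (cent c) (psi z); rewrite psiK (metric_sym z).
have : L%:num * mdist (cent c) (psi z) <= L%:num * rho n.+1 by rewrite ler_pM2l.
have -> : (L%:num ^+ 2 + 1) * (rho n.+1 / L%:num) =
    L%:num * rho n.+1 + rho n.+1 / L%:num.
  rewrite mulrDl mul1r expr2 -mulrA.
  by rewrite [in X in X + _](mulrCA L%:num (rho n.+1)) divff ?mulr1.
by lra.
Qed.
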